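(* Let $(S,\preceq)$ be a standard discrete poset whose covering graph is a rooted tree without leaves, with root $e$, and let $\alpha>0$. Then $F:S\to(0,1]$ is the upper probability function of a distribution on $S$ with constant rate $\alpha$ if and only if $F(e)=1$ and $$\sum_{y\in A(x)}F(y)=(1-\alpha)F(x),\qquad x\in S.$$
   Context: A standard discrete poset is a countable poset $(S,\preceq)$ such that $\{t\in S: t\preceq x\}$ is finite for each $x\in S$ (with the discrete topology and counting measure as reference measure). Its covering graph has vertex set $S$ and a directed edge $(x,y)$ whenever $y$ covers $x$ (i.e. $y$ is a minimal element of $\{t: t\succ x\}$). When this graph is a rooted tree, the root $e$ is the minimum element of $S$; $A(x)$ denotes the set of children of $x$ (elements covering $x$); a leaf is a vertex with no children. Distributions on $S$ have support $S$ (i.e. give positive probability to every point). The upper probability function of a random variable $X$ is $F(x)=\mathbb{P}(X\succeq x)$, and its PDF is $f(x)=\mathbb{P}(X=x)$. $X$ has constant rate $\alpha>0$ if $f=\alpha F$. *)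

(* Defs.v *)
From HB Require Import structures.
From mathcomp Require Import all_boot all_order all_algebra.
From mathcomp Require Import all_classical all_reals all_analysis.

Set Implicit Arguments.
Unset Strict Implicit.
Unset Printing Implicit Defensive.

Import Order.TTheory GRing.Theory Num.Theory.

Local Open Scope classical_set_scope.
Local Open Scope ring_scope.

Section Posets.
Context {disp : Order.disp_t} {S : porderType disp}.
Implicit Types (x y e : S).

Definition standard_discrete : Prop :=
  countable [set: S] /\ forall x, finite_set [set t : S | (t <= x)%O].

(* y is a minimal element of {t : x < t}. *)
Definition covers x y : Prop :=
  (x < y)%O /\ forall t, (x < t)%O -> ~ (t < y)%O.

Definition children x : set S := [set y | covers x y].

Definition leaf x : Prop := children x = set0.

(* The covering graph, with edges (x, y) for y covering x, is a tree rooted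
   at e: each vertex is the end of exactly one directed path from e.  Here p
   lists the vertices of the path after e. *)
Definition rooted_tree e : Prop :=
  forall x, exists! p : seq S,
    path (fun u v => `[< covers u v >]) e p /\ last e p = x.

Lemma rooted_tree_min e : rooted_tree e -> forall x, (e <= x)%O.
Proof.
move=> te x; have [p [[ep <-] _]] := te x.
elim: p e ep {te} => //= y p IHp e /andP[/asboolP[/ltW ey _] yp].
exact: le_trans ey (IHp y yp).
Qed.

End Posets.

Arguments standard_discrete {disp} S.

(* S with all its subsets measurable.  Measurable types are pointed, and the
   argument e provides the point; it plays no other role. *)
Definition discrete_space {disp} {S : porderType disp} (e : S) : Type := S.

Section DiscreteSpace.
Context {disp : Order.disp_t} {S : porderType disp} (e : S).

HB.instance Definition _ := Choice.copy (discrete_space e) S.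
HB.instance Definition _ := isPointed.Build (discrete_space e) (e : S).
HB.instance Definition _ := @isMeasurable.Build default_measure_display
  (discrete_space e) discrete_measurable
  discrete_measurable0 discrete_measurableC discrete_measurableU.

End DiscreteSpace.

Section Distributions.
Context {disp : Order.disp_t} {S : porderType disp} {e : S} {R : realType}.
Implicit Type P : probability (discrete_space e) R.

Definition upper_prob P (x : S) : R := fine (P [set t : S | (x <= t)%O]).

Definition pdf P (x : S) : R := fine (P [set x]).

Definition full_support P : Prop := forall x : S, 0 < pdf P x.

Definition constant_rate P (alpha : R) : Prop :=
  forall x : S, pdf P x = alpha * upper_prob P x.

End Distributions.

(* Main.v *)
Require Import Defs.
From HB Require Import structures.
From mathcomp Require Import all_boot all_order all_algebra.
From mathcomp Require Import all_classical all_reals all_analysis.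

(** The theorem is a local balance equation together with a geometric series.
    Write up(x) for the set of points above x.  In a rooted tree up(x) is the
    disjoint union of {x} and of the sets up(y), y a child of x
    (up_set_children, trivIset_children): by finiteness of the sets of points
    below a given one, every point above x is reached from x by a path in the
    covering graph, and two children of x with a common point above them would
    yield two paths from the root to that point.

    Hence every distribution satisfies F(x) = f(x) + sum of F over the children
    of x (probability_up_set_children), and f = alpha F turns this into the
    stated equation.

    Conversely, let F satisfy the equation, and cut up(x) into levels, the
    n-th level being the set of the descendants of x that are n edges away.
    Iterating the equation, the sum of F over this level is
    (1 - alpha)^n F(x) (esum_level).  The root has a child, where F is
    positive, so that 0 < 1 - alpha < 1 and the sum of alpha F over up(x) is
    alpha F(x) / (1 - (1 - alpha)) = F(x) (esum_up_set).  For x = e the total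
    mass is F(e) = 1, and thus alpha F is the density of a probability, whose
    upper probability function is F by the same formula. *)

Set Implicit Arguments.
Unset Strict Implicit.
Unset Printing Implicit Defensive.

Import Order.TTheory GRing.Theory Num.Theory.

Local Open Scope classical_set_scope.
Local Open Scope ring_scope.

(** * Sums of nonnegative families *)

Section EsumComplements.
Context {R : realType}.
Local Open Scope ereal_scope.

(** Disjointness is only asked for indices in K: the sets of points above two
    vertices may meet, unless these vertices are siblings. *)
Lemma esum_bigcup_in (I T : choiceType) (K : set I) (J : I -> set T)
    (a : T -> \bar R) : trivIset K J -> (forall x, 0 <= a x) ->
  \esum_(t in \bigcup_(k in K) J k) a t = \esum_(k in K) \esum_(t in J k) a t.
Proof.
move=> tJ a0; rewrite esum_esum//; apply: reindex_esum => //; split.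
- by move=> [/= i j] [Ki Jij]; exists i.
- move=> [/= i1 j1] [/= i2 j2] /[!inE] -[/= K1 J1] [/= K2 J2] j12.
  rewrite -j12 in J2 *; congr (_, _).
  by apply: (tJ _ _ K1 K2); exists j1.
- by move=> j [i Ki Jij]; exists (i, j).
Qed.

Lemma esum_ge_term (T : choiceType) (A : set T) (a : T -> \bar R) t :
  A t -> a t <= \esum_(i in A) a i.
Proof.
move=> At; apply: esum_ge; exists [set t]; last by rewrite fsbig_set1.
by split=> [|_ ->]; first exact: finite_set1.
Qed.

Let esumZl_le (T : choiceType) (A : set T) (c : R) (a : T -> \bar R) :
  (0 <= c)%R -> (forall t, 0 <= a t) ->
  \esum_(t in A) (c%:E * a t) <= c%:E * \esum_(t in A) a t.
Proof.
move=> c0 a0; apply: ge_ereal_sup => _ [X XA <-].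
rewrite -ge0_mule_fsumr//; apply: lee_wpmul2l; first by rewrite lee_fin.
by apply: esum_ge; exists X.
Qed.

(** The lower bound is the upper bound for the family c * a and the factor
    c^-1. *)
Lemma esumZl (T : choiceType) (A : set T) (c : R) (a : T -> \bar R) :
  (0 < c)%R -> (forall t, 0 <= a t) ->
  \esum_(t in A) (c%:E * a t) = c%:E * \esum_(t in A) a t.
Proof.
move=> c0 a0; apply/eqP; rewrite eq_le (esumZl_le _ (ltW c0) a0)/=.
rewrite -lee_pdivlMl//.
have ca0 t : 0 <= c%:E * a t by rewrite mule_ge0// lee_fin ltW.
have cV0 : (0 <= c^-1)%R by rewrite invr_ge0 ltW.
apply: le_trans (esumZl_le A cV0 ca0).
by apply: le_esum => t _; rewrite muleA -EFinM mulVf ?gt_eqF// mul1e.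
Qed.

End EsumComplements.

(** * Discrete measures *)

Section DiscreteMeasures.
Context {d : measure_display} {T : measurableType d} {R : realType}.
Local Open Scope ereal_scope.

Lemma measure_countable_esum (mu : {measure set T -> \bar R}) (A : set T) :
  (forall t : T, measurable [set t]) -> countable A ->
  mu A = \esum_(t in A) mu [set t].
Proof.
move=> m1 /countable_bijP[B]; rewrite card_eq_sym => /card_set_bijP[h hbij].
rewrite (reindex_esum B A h _ hbij).
have -> : A = \bigcup_(n in B) [set h n].
  by rewrite bigcup_imset1 (surj_image_eq _ (set_bij_surj hbij))//;
     exact: set_bij_sub hbij.
rewrite measure_bigcup//=.
  by rewrite nneseries_esum// set_mem_set.
move=> i j Bi Bj [t [-> ij]].
by apply: (set_bij_inj hbij) => //; rewrite inE.
Qed.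

Lemma esum_probability (f : T -> \bar R) :
  (forall t, 0 <= f t) -> \esum_(t in [set: T]) f t = 1 ->
  exists P : probability T R, forall A, P A = \esum_(t in A) f t.
Proof.
move=> f0 f1; pose mu (A : set T) := \esum_(t in A) f t.
have mu0 : mu set0 = 0 by exact: esum_set0.
have mu_ge0 A : 0 <= mu A by exact: esum_ge0.
have mu_add : semi_sigma_additive mu.
  move=> A mA tA mUA; apply: cvg_toP.
    apply: ereal_nondecreasing_is_cvgn => a b ab.
    exact: lee_sum_nneg_natr.
  by rewrite /mu nneseries_sum_bigcup.
pose mum := isMeasure.Build _ _ _ mu mu0 mu_ge0 mu_add.
pose muM : {measure set T -> \bar R} := HB.pack mu mum.
pose mup := Measure_isProbability.Build _ _ _ muM f1.
pose muP : probability T R := HB.pack mu mum mup.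
by exists muP.
Qed.

End DiscreteMeasures.

(** * Upper sets of a tree *)

Section Trees.
Context {disp : Order.disp_t} {S : porderType disp}.
Implicit Types (x y t : S).

Local Notation cpath := (path (fun u v : S => `[< covers u v >])).

Definition up_set x : set S := [set t | (x <= t)%O].

(** If t does not cover x, some u lies strictly between them, and paths from x
    to u and from u to t are concatenated; finiteness makes this end. *)
Lemma cpath_of_finite_interval (s : seq S) x t :
  (forall z, (x <= z <= t)%O -> z \in s) -> (x <= t)%O ->
  exists2 p, cpath x p & last x p = t.
Proof.
have [n] := ubnP (size s); elim: n s x t => // n IHn s x t sn sP xt.
have [<-|nxt] := eqVneq x t; first by exists [::].
have {nxt}xt' : (x < t)%O by rewrite lt_neqAle nxt.
have [cxt|ncxt] := pselect (covers x t).
  by exists [:: t] => //=; rewrite andbT; exact/asboolP.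
have [u [xu ut]] : exists u, (x < u)%O /\ (u < t)%O.
  apply: contrapT => nu; apply: ncxt; split=> // u xu ut.
  by apply: nu; exists u.
(* Splitting at u, each half interval misses one end point of [x, t]. *)
have lt_filter z : z \in s -> (size [seq w <- s | w != z] < n)%N.
  move=> zs; move: sn; rewrite ltnS; apply: leq_trans; rewrite size_filter.
  rewrite ltn_neqAle count_size andbT -all_count.
  by apply/allPn; exists z; rewrite // eqxx.
have xs : x \in s by apply: sP; rewrite lexx.
have ts : t \in s by apply: sP; rewrite lexx andbT.
have [p ep lp] : exists2 p, cpath x p & last x p = u.
  apply: IHn (lt_filter _ ts) _ (ltW xu) => z /andP[xz zu].
  rewrite mem_filter (lt_eqF (le_lt_trans zu ut))/=.
  by apply: sP; rewrite xz (le_trans zu (ltW ut)).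
have [q eq lq] : exists2 p, cpath u p & last u p = t.
  apply: IHn (lt_filter _ xs) _ (ltW ut) => z /andP[uz zt].
  rewrite mem_filter (gt_eqF (lt_le_trans xu uz))/=.
  by apply: sP; rewrite zt (le_trans (ltW xu) uz).
by exists (p ++ q); rewrite ?cat_path ?last_cat ?lp ?ep.
Qed.

Hypothesis S_std : standard_discrete S.

Lemma le_cpath x t : (x <= t)%O -> exists2 p, cpath x p & last x p = t.
Proof.
have [_ /(_ t)/finite_seqP[s sE]] := S_std.
apply: (cpath_of_finite_interval (s := s)) => z /andP[_ zt].
by have : [set` s] z by rewrite -sE.
Qed.

Lemma up_set_children x :
  up_set x = [set x] `|` \bigcup_(y in children x) up_set y.
Proof.
apply/seteqP; split=> t /=.
  move=> /le_cpath[[|y p] /=]; first by move=> _ ->; left.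
  move=> /andP[/asboolP cxy yp] <-; right; exists y => //=.
  elim: p y {cxy} yp => [|z p IHp] y /=; first by move=> _; exact: lexx.
  by move=> /andP[/asboolP[/ltW yz _] /IHp]; exact: le_trans.
by move=> [->|[y [/ltW xy _] yt]]; [exact: lexx|exact: le_trans xy yt].
Qed.

Variable e : S.
Hypothesis S_tree : rooted_tree e.

(** A point above two children y and y' of x would be reached from the root by
    a path through y and by a path through y'. *)
Lemma trivIset_children x : trivIset (children x) up_set.
Proof.
move=> y y' cy cy' [t [/= /le_cpath[q yq lq] /le_cpath[q' yq' lq']]].
have [p [[ep lp] _]] := S_tree x.
have [r [_ r_uniq]] := S_tree t.
have path_via z (w : seq S) : children x z -> cpath z w -> last z w = t ->
    r = p ++ z :: w.
  move=> cz zw lw; apply: r_uniq; rewrite cat_path last_cat ep lp/= zw andbT.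
  by split=> //; exact/asboolP.
have /eqP := path_via _ _ cy yq lq.
rewrite (path_via _ _ cy' yq' lq') eqseq_cat// eqxx /= eqseq_cons.
by move=> /andP[/eqP ->].
Qed.

(** The descendants of x at distance n in the covering graph, peeled off from
    the top edge: the induction then applies to every child of x, and siblings
    have disjoint levels. *)
Fixpoint level n x : set S :=
  if n is m.+1 then \bigcup_(y in children x) level m y else [set x].

Lemma level_up_set n x : level n x `<=` up_set x.
Proof.
elim: n x => [|n IHn] x t /=; first by move=> ->; exact: lexx.
by move=> [y [/ltW xy _] /IHn]; exact: le_trans.
Qed.

Lemma trivIset_level_children n x : trivIset (children x) (level n).
Proof.
move=> y y' cy cy' [t [/level_up_set yt /level_up_set y't]].
by apply: (trivIset_children cy cy'); exists t.
Qed.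

(** A common point of levels m.+1 and n.+1 of x lies above a single child of x,
    in levels m and n of this child. *)
Lemma trivIset_level x : trivIset [set: nat] (level ^~ x).
Proof.
move=> m n _ _; elim: m n x => [|m IHm] [|n] x //=.
- move=> [t [-> [y [xy _] /level_up_set yx]]].
  by have := lt_le_trans xy yx; rewrite ltxx.
- move=> [t [[y [xy _] /level_up_set yx] tx]]; rewrite tx in yx.
  by have := lt_le_trans xy yx; rewrite ltxx.
- move=> [t [[y cy yt] [y' cy' yt']]]; congr _.+1.
  have yy' : y = y'.
    apply: (trivIset_children cy cy').
    by exists t; split; [exact: level_up_set yt|exact: level_up_set yt'].
  by apply: (IHm _ y); exists t; split => //; rewrite yy'.
Qed.

Lemma up_set_levels x : up_set x = \bigcup_n level n x.
Proof.
apply/seteqP; split=> t; last by move=> [n _ /level_up_set].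
move=> /= /le_cpath[p]; elim: p x => [|y p IHp] x /=.
  by move=> _ ->; exists 0%N.
move=> /andP[/asboolP cxy yp] /(IHp _ yp)[n _ nt].
by exists n.+1 => //; exists y.
Qed.

End Trees.

(** * Constant rate *)

Section ConstantRate.
Context {R : realType} {disp : Order.disp_t} {S : porderType disp}.
Variables (e : S) (alpha : R) (F : S -> R).
Hypotheses (S_std : standard_discrete S) (S_tree : rooted_tree e).
Local Open Scope ereal_scope.

Lemma probability_up_set_children (P : probability (discrete_space e) R) x :
  P (up_set x) = P [set x] + \esum_(y in children x) P (up_set y).
Proof.
have PE (A : set S) : P A = \esum_(t in A) P [set t].
  apply: (@measure_countable_esum _ (discrete_space e)) => //.
  by apply: sub_countable (proj1 S_std); exact/subset_card_le.
rewrite up_set_children// measureU//; last first.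
  rewrite -subset0 => t [/= -> [y [xy _] /= yx]].
  by have := lt_le_trans xy yx; rewrite ltxx.
congr (_ + _); apply: etrans (PE (\bigcup_(y in children x) up_set y)) _.
rewrite esum_bigcup_in//; last exact: trivIset_children.
by apply: eq_esum => y _; rewrite -PE.
Qed.

Hypotheses (alpha_gt0 : (0 < alpha)%R) (alpha_lt1 : (alpha < 1)%R).
Hypothesis F_ge0 : forall x, (0 <= F x)%R.
Hypothesis F_children : forall x,
  \esum_(y in children x) (F y)%:E = ((1 - alpha) * F x)%:E.

Lemma esum_level n x :
  \esum_(t in level n x) (F t)%:E = ((1 - alpha) ^+ n * F x)%:E.
Proof.
have F0 t : 0 <= (F t)%:E by rewrite lee_fin.
elim: n x => [|n IHn] x /=; first by rewrite esum_set1// expr0 mul1r.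
rewrite esum_bigcup_in//; last exact: trivIset_level_children.
under eq_esum do rewrite IHn EFinM.
rewrite esumZl//; last by rewrite exprn_gt0// subr_gt0.
by rewrite F_children -EFinM mulrA -exprSr.
Qed.

Lemma esum_up_set x : \esum_(t in up_set x) (alpha * F t)%:E = (F x)%:E.
Proof.
have F0 t : 0 <= (F t)%:E by rewrite lee_fin.
under eq_esum do rewrite EFinM.
rewrite esumZl// up_set_levels// esum_bigcup_in//; last exact: trivIset_level.
under eq_esum do rewrite esum_level.
have p0 n : (0 <= (1 - alpha) ^+ n * F x)%R.
  by rewrite mulr_ge0// exprn_ge0// subr_ge0 ltW.
rewrite -nneseries_esumT; last by move=> n; rewrite lee_fin.
rewrite -nneseriesZl; last by move=> n _; rewrite lee_fin.
have z1 : (`|1 - alpha| < 1)%R by rewrite gtr0_norm ?subr_gt0// gtrBl.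
have geoE n : \sum_(0 <= k < n) alpha%:E * ((1 - alpha) ^+ k * F x)%:E =
    (series (geometric (alpha * F x) (1 - alpha)) n)%:E.
  rewrite /series/= -sumEFin; apply: eq_bigr => k _.
  by rewrite -EFinM mulrCA mulrC.
apply/cvg_lim => //; under eq_fun do rewrite geoE.
apply: cvg_EFin; first exact: nearW.
have := @cvg_geometric_series _ (alpha * F x)%R _ z1.
by rewrite subKr (mulrAC alpha (F x)) mulfV ?gt_eqF// mul1r.
Qed.

End ConstantRate.

Theorem corollary2 (R : realType) (disp : Order.disp_t) (S : porderType disp)
    (e : S) (alpha : R) (F : S -> R)
    (S_std : standard_discrete S)
    (S_tree : rooted_tree e)
    (S_noleaf : forall x : S, ~ leaf x)
    (alpha_gt0 : 0 < alpha)
    (F_range : forall x : S, 0 < F x <= 1) :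
  (exists P : probability (discrete_space e) R,
     [/\ full_support P,
         constant_rate P alpha &
         forall x : S, F x = upper_prob P x])
  <->
  (F e = 1 /\
   forall x : S,
     (\esum_(y in children x) (F y)%:E = ((1 - alpha) * F x)%:E)%E).
Proof.
have up_e : up_set e = [set: S].
  by apply/seteqP; split=> // x _; exact: rooted_tree_min.
have F_gt0 x : 0 < F x by have /andP[] := F_range x.
split=> [[P [_ P_rate FP]]|[Fe1 F_children]].
  have FE x : P (up_set x) = (F x)%:E.
    by rewrite FP fineK// fin_num_measure.
  split=> [|x].
    by apply: EFin_inj; rewrite -FE up_e; exact: probability_setT.
  have fE : P [set x] = (alpha * F x)%:E.
    by rewrite FP -P_rate fineK// fin_num_measure.
  have := probability_up_set_children S_std S_tree P x.
  under eq_esum do rewrite FE.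
  rewrite FE fE; case: esum => // r [Fr]; congr EFin.
  by rewrite mulrBl mul1r [X in X - _]Fr addrAC subrr add0r.
have alpha_lt1 : alpha < 1.
  have [y ye] : children e !=set0 by apply/set0P/eqP; exact: S_noleaf.
  have := F_children e; rewrite Fe1 mulr1 -subr_gt0 -lte_fin => <-.
  by apply: lt_le_trans (esum_ge_term _ ye); rewrite lte_fin.
have F_up := esum_up_set S_std S_tree alpha_gt0 alpha_lt1
  (fun x => ltW (F_gt0 x)) F_children.
have f_ge0 t : (0 <= (alpha * F t)%:E)%E by rewrite lee_fin mulr_ge0 ?ltW.
have [|P PE] := @esum_probability _ (discrete_space e) R _ f_ge0.
  by rewrite -[setT]up_e F_up Fe1.
have FP x : F x = upper_prob P x by rewrite /upper_prob PE F_up.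
have fP x : pdf P x = alpha * F x by rewrite /pdf PE esum_set1.
exists P; split=> // x; last by rewrite fP FP.
by rewrite fP mulr_gt0.
Qed.
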